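(* There exists a purely absolutely continuous probability measure $d\gamma_0$ supported on $[-2,2]$ (with no eigenvalues, i.e. no pure points, outside $[-2,2]$) such that for every $x_0\in\mathbb{R}\setminus[-2,2]$ and every $0<\beta<1$, the measure $$d\tilde\gamma(x)=(1-\beta)\,d\gamma_0(x)+\beta\,\delta_{x_0}$$ is a non-exponential perturbation of $d\gamma_0$ at the level of recursion coefficients: neither of the differences $a_n(d\tilde\gamma)-a_n(d\gamma_0)$ and $b_n(d\tilde\gamma)-b_n(d\gamma_0)$ decays exponentially as $n\to\infty$. That is, there are no constants $C,c>0$ with $|a_n(d\tilde\gamma)-a_n(d\gamma_0)|\le Ce^{-cn}$ for all $n\geq 1$, and there are no constants $C,c>0$ with $|b_n(d\tilde\gamma)-b_n(d\gamma_0)|\le Ce^{-cn}$ for all $n\ge 1$.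
   Context: For a probability measure $d\gamma$ on $\mathbb{R}$ with compact infinite support, let $(p_n(x))_{n\ge0}$ be the orthonormal polynomials obtained by applying Gram--Schmidt to $1,x,x^2,\dots$ in $L^2(\mathbb{R},d\gamma)$, with positive leading coefficients. They satisfy the three-term recursion $$xp_n(x)=a_{n+1}p_{n+1}(x)+b_{n+1}p_n(x)+a_np_{n-1}(x),\qquad n\ge0,\quad p_{-1}\equiv0,$$ with $a_n>0$ and $b_n\in\mathbb{R}$ for $n\geq 1$. The numbers $a_n=a_n(d\gamma)$ and $b_n=b_n(d\gamma)$ are the recursion coefficients of $d\gamma$. $\delta_{x_0}$ denotes the unit point mass at $x_0$. ''Non-exponential perturbation'' means that the changes in the recursion coefficients do not decay exponentially in $n$. *)

(* Defs.v *)
From HB Require Import structures.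
From mathcomp Require Import all_boot all_order all_algebra.
From mathcomp Require Import all_classical all_reals all_analysis.
Import Order.TTheory GRing.Theory Num.Theory.
Import numFieldNormedType.Exports.

Set Implicit Arguments.
Unset Strict Implicit.
Unset Printing Implicit Defensive.

Local Open Scope classical_set_scope.
Local Open Scope ring_scope.

Section insert_mass.
Context {R : realType}.
Variables (mu : probability (measurableTypeR R) R) (x0 beta : R).
Hypotheses (beta_gt0 : 0 < beta) (beta_lt1 : beta < 1).

Let onem_beta_ge0 : 0 <= 1 - beta.
Proof. by rewrite subr_ge0 ltW. Qed.

Definition insert_mass : set (measurableTypeR R) -> \bar R :=
  measure_add (mscale (NngNum onem_beta_ge0) mu)
              (mscale (NngNum (ltW beta_gt0)) (dirac (x0 : measurableTypeR R))).

HB.instance Definition _ := Measure.on insert_mass.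

Lemma insert_massE A :
  insert_mass A = ((1 - beta)%:E * mu A + beta%:E * \d_x0 A)%E.
Proof. by rewrite /insert_mass measure_addE. Qed.

Let insert_mass_setT : insert_mass setT = 1%E.
Proof.
by rewrite insert_massE probability_setT diracT !mule1 -EFinD subrK.
Qed.

HB.instance Definition _ :=
  Measure_isProbability.Build _ _ _ insert_mass insert_mass_setT.

End insert_mass.

Section recursion_coefficients.
Context {R : realType}.
Variable mu : {measure set (measurableTypeR R) -> \bar R}.

Definition msupport : set R :=
  [set x | forall U : set R, open U -> U x -> (0 < mu U)%E].

Definition L2dot (p q : {poly R}) : R := (\int[mu]_x (p.[x] * q.[x]))%R.

(* The first [n] orthonormal polynomials. Each [u] is monic, and it has nonzero
   norm when [mu] has compact infinite support, so that the leading coefficient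
   of its normalization is then positive. *)
Fixpoint gram_schmidt (n : nat) : seq {poly R} :=
  if n is m.+1 then
    let s := gram_schmidt m in
    let u := 'X^m - \sum_(p <- s) L2dot 'X^m p *: p in
    rcons s ((Num.sqrt (L2dot u u))^-1 *: u)
  else [::].

Definition orthonormal_poly (n : nat) : {poly R} := (gram_schmidt n.+1)`_n.

(* [a 0] is irrelevant: it only multiplies p_{-1} = 0. *)
Definition recursion_coefs (a b : nat -> R) : Prop :=
  (forall n, (1 <= n)%N -> 0 < a n) /\
  (forall n, 'X * orthonormal_poly n =
     a n.+1 *: orthonormal_poly n.+1 + b n.+1 *: orthonormal_poly n +
     a n *: (if n is m.+1 then orthonormal_poly m else 0)).

End recursion_coefficients.

Definition exp_decay {R : realType} (u : nat -> R) : Prop :=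
  exists C c : R, [/\ 0 < C, 0 < c &
    forall n, (1 <= n)%N -> `|u n| <= C * expR (- (c * n%:R))].

(* Main.v *)
Require Import Defs.
From HB Require Import structures.
From mathcomp Require Import all_boot all_order all_algebra.
From mathcomp Require Import all_classical all_reals all_analysis.
From mathcomp Require Import measurable_realfun ring lra.
Import Order.TTheory GRing.Theory Num.Theory.
Import numFieldNormedType.Exports.

Set Implicit Arguments.
Unset Strict Implicit.
Unset Printing Implicit Defensive.

Local Open Scope classical_set_scope.
Local Open Scope ring_scope.

(** The measure is the uniform law on [[-2, 2]], whose orthogonal polynomials are
the rescaled Legendre polynomials, with [b_n = 0] and
[a_n ^ 2 = 4 n ^ 2 / (4 n ^ 2 - 1)] ([legendre_monic_orthogonal]). These
coefficients converge to those of the free case only polynomially fast, and a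
point mass outside the support reveals this rate.

Write [q_n] for the monic polynomials, [h_n] for their squared norms, and let the
new measure be proportional to the old one plus a mass [lam] at [x0]. Put
[D_n = 1 + lam * sum_(k < n) q_k(x0) ^ 2 / h_k]. Subtracting from [q_n] a multiple
of the Christoffel--Darboux kernel gives the new monic polynomials
([mass_monic_orthogonal]); comparing norms and subleading coefficients, the square
of the new first coefficient is [a_n ^ 2 * D_(n+1) * D_(n-1) / D_n ^ 2], and the
difference of the second coefficients is [s_n - s_(n-1)] where
[s_n = lam * q_n(x0) * q_(n+1)(x0) / (h_n * D_(n+1))].

Suppose that one of the differences decays exponentially. Since [|x0| > 2], the
values [q_n(x0)] grow by a definite factor at each step, so that the ratios
between [D_n] and its increments stay bounded, and the ratios of consecutive
orthonormal or monic polynomials at [x0] can be recovered from the [D_n] or the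
[s_n] up to an exponentially small error. Those ratios then have exponentially
small increments. But they determine the [a_n ^ 2] through the three-term
recursion at [x0], and so the increments of [a_n ^ 2] would be exponentially
small, whereas they are of order [n ^ -3]. The two cases are
[a_perturbation_not_exp_decay] and [b_perturbation_not_exp_decay]. *)

(** * Integration of polynomials *)

Section expectation.
Context {R : realType}.
Implicit Types p q : {poly R}.

Definition poly_integral (mu : {measure set (measurableTypeR R) -> \bar R}) p
  : R := (\int[mu]_x p.[x])%R.

Lemma L2dotE (mu : {measure set (measurableTypeR R) -> \bar R}) p q :
  L2dot mu p q = poly_integral mu (p * q).
Proof. by apply: eq_Rintegral => x _; rewrite hornerM. Qed.

Definition integrates_polys
    (mu : {measure set (measurableTypeR R) -> \bar R}) :=
  forall p, mu.-integrable setT (EFin \o horner p).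

Lemma measurable_horner p :
  measurable_fun (setT : set R) (EFin \o horner p : R -> \bar R).
Proof.
apply/measurable_EFinP; apply: continuous_measurable_fun.
exact: continuous_horner.
Qed.

Lemma poly_integral_linear mu c p q : integrates_polys mu ->
  poly_integral mu (c *: p + q) = c * poly_integral mu p + poly_integral mu q.
Proof.
move=> ip; rewrite /poly_integral.
under eq_Rintegral do rewrite hornerD hornerZ.
rewrite RintegralD//; last first.
  rewrite [X in integrable _ _ X](_ : _ = EFin \o horner (c *: p)) //.
  by apply/funext => x /=; rewrite hornerZ.
by rewrite RintegralZl//; exact: ip.
Qed.

Lemma poly_integral1 (mu : probability (measurableTypeR R) R) :
  poly_integral mu 1 = 1.
Proof.
rewrite /poly_integral.
under eq_Rintegral do rewrite hornerC.
by rewrite Rintegral_cst//= probability_setT mulr1.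
Qed.
End expectation.

Section uniform.
Context {R : realType} (a b : R) (ab : a < b).
Let mu := @lebesgue_measure R.

Lemma continuous_within_horner (p : {poly R}) (A : set R) :
  {within A, continuous (horner p)}.
Proof. apply: continuous_subspaceT; exact: continuous_horner. Qed.

Lemma integrable_horner_itv (p : {poly R}) :
  mu.-integrable `[a, b] (EFin \o horner p).
Proof.
apply: continuous_compact_integrable; first exact: segment_compact.
exact: continuous_within_horner.
Qed.

Lemma integrates_polys_uniform : integrates_polys (uniform_prob ab).
Proof.
move=> p; apply/integrableP; split; first exact: measurable_horner.
rewrite integral_uniform//; last first.
  apply: measurableT_comp => //; exact: measurable_horner.
apply: lte_mul_pinfty => //.
  by rewrite lee_fin invr_ge0 subr_ge0 ltW.
by have /integrableP[] := integrable_horner_itv p.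
Qed.

(** Since [integral_uniform] concerns nonnegative functions, the positive and
negative parts are treated separately; the fundamental theorem of calculus then
evaluates the Lebesgue integral. *)
Lemma poly_integral_uniform_deriv p :
  poly_integral (uniform_prob ab) p^`() = (p.[b] - p.[a]) / (b - a).
Proof.
have -> : poly_integral (uniform_prob ab) p^`() =
    fine ((b - a)^-1%:E * \int[mu]_(x in `[a, b]) (p^`().[x])%:E).
  congr fine; have ip := integrable_horner_itv p^`().
  have mp := measurable_horner p^`().
  rewrite [LHS]integralE (integralE mu `[a, b] (EFin \o horner p^`())).
  rewrite !integral_uniform//; last 2 first.
  - exact: measurable_funeneg.
  - exact: measurable_funepos.
  rewrite [RHS]muleBr//; apply: fin_num_adde_defr.
  exact: integrable_pos_fin_num.
rewrite (continuous_FTC2 ab (F := horner p)).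
- by rewrite -EFinB -EFinM /= mulrC.
- exact: continuous_within_horner.
- split.
  + by move=> x _; exact: derivable_horner.
  + by apply: cvg_at_right_filter; exact: continuous_horner.
  + by apply: cvg_at_left_filter; exact: continuous_horner.
- by move=> x _; rewrite -derivE.
Qed.

End uniform.

Section insert_mass.
Context {R : realType} (mu : probability (measurableTypeR R) R) (x0 beta : R).
Hypotheses (beta_gt0 : 0 < beta) (beta_lt1 : beta < 1).
Let nu := insert_mass mu x0 beta_gt0 beta_lt1.

Lemma ge0_integral_insert_mass (f : measurableTypeR R -> \bar R) :
  measurable_fun setT f -> (forall x, 0 <= f x)%E ->
  (\int[nu]_x f x = (1 - beta)%:E * \int[mu]_x f x + beta%:E * f x0)%E.
Proof.
move=> mf f0.
rewrite /nu /insert_mass.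
rewrite ge0_integral_measure_add// !ge0_integral_mscale//.
by rewrite integral_dirac//= diracT mul1e.
Qed.

Lemma integrates_polys_insert_mass : integrates_polys mu -> integrates_polys nu.
Proof.
move=> ip p; apply/integrableP; split; first exact: measurable_horner.
rewrite ge0_integral_insert_mass//; last first.
  by apply: measurableT_comp => //; exact: measurable_horner.
apply: lte_add_pinfty; last by rewrite -EFinM ltry.
apply: lte_mul_pinfty => //; first by rewrite lee_fin subr_ge0 ltW.
by have /integrableP[] := ip p.
Qed.

Lemma poly_integral_insert_mass p : integrates_polys mu ->
  poly_integral nu p = (1 - beta) * poly_integral mu p + beta * p.[x0].
Proof.
move=> ip; have mp := measurable_horner p.
have fp := integrable_pos_fin_num measurableT (ip p).
have fn := integrable_neg_fin_num measurableT (ip p).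
have -> : poly_integral nu p =
    fine ((1 - beta)%:E * \int[mu]_x (p.[x])%:E + beta%:E * (p.[x0])%:E)%E.
  congr fine; rewrite [LHS]integralE (integralE mu setT (EFin \o horner p)).
  rewrite !ge0_integral_insert_mass//; last 2 first.
  - exact: measurable_funeneg.
  - exact: measurable_funepos.
  rewrite [in RHS](_ : (p.[x0])%:E =
     ((EFin \o horner p)^\+ x0 - (EFin \o horner p)^\- x0)%E); last first.
    by have /(congr1 (@^~ x0)) := funeposneg (EFin \o horner p).
  have fpx : ((EFin \o horner p)^\+ x0)%E \is a fin_num.
    by rewrite funeposE/= -EFin_max.
  have fnx : ((EFin \o horner p)^\- x0)%E \is a fin_num.
    by rewrite funenegE/= -EFin_max.
  rewrite -(fineK fp) -(fineK fn) -(fineK fpx) -(fineK fnx).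
  by rewrite -!(EFinN,EFinM,EFinD); congr (_%:E); ring.
by rewrite -(fineK (integrable_fin_num measurableT (ip p))).
Qed.
End insert_mass.

Section uniform_support.
Context {R : realType} (a b : R) (ab : a < b).
Let mu := @lebesgue_measure R.

Lemma uniform_prob_itv_gt0 (c d : R) : a <= c -> c < d -> d <= b ->
  (0 < uniform_prob ab `[c, d])%E.
Proof.
move=> ac cd db; rewrite /uniform_prob.
rewrite (eq_integral (cst ((b - a)^-1%:E))); last first.
  move=> x /[!inE] /= /[!in_itv] /= /andP[cx xd].
  by rewrite /uniform_pdf (le_trans ac cx) (le_trans xd db).
rewrite integral_cst//= lebesgue_measure_itv/= lte_fin cd -EFinB -EFinM lte_fin.
by rewrite mulr_gt0// ?invr_gt0 subr_gt0.
Qed.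

(** A neighbourhood of a point of [[a, b]] contains a nondegenerate closed
subinterval of [[a, b]], even when the point is an endpoint: hence the maximum
and the minimum in the choice of that subinterval. *)
Lemma msupport_uniform : msupport (uniform_prob ab) = `[a, b]%classic.
Proof.
apply/seteqP; split => [x|x] /=.
  move=> xs; apply: contrapT => xab.
  have oU : open (~` `[a, b]%classic).
    by rewrite openC; exact: itv_closed.
  have U0 : uniform_prob ab (~` `[a, b]%classic) = 0%E.
    by rewrite /uniform_prob integral_uniform_pdf setICl integral_set0.
  suff: (0 < uniform_prob ab (~` `[a, b]%classic))%E by rewrite U0 ltxx.
  exact: xs.
rewrite in_itv/= => /andP[ax xb] U oU Ux.
have /nbhs_ballP[e /= e0 xeU] : nbhs x U by exact: open_nbhs_nbhs.
have mU : measurable (U : set (measurableTypeR R)) by exact: open_measurable.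
have [f f0 fU] : exists2 f : R, 0 < f & forall y, x - f <= y <= x + f -> U y.
  exists (e / 2) => [|y /andP[y1 y2]]; first by rewrite divr_gt0.
  apply: xeU; rewrite /ball/= ltr_norml.
  have e2 : e / 2 < e by rewrite ltr_pdivrMr// mulr2n mulrDr mulr1 ltrDl.
  apply/andP; split.
    by rewrite ltrNl opprB ltrBlDl (le_lt_trans y2)// ltrD2l.
  by rewrite ltrBlDl (@le_lt_trans _ _ (y + e / 2)) -?lerBlDr// ltrD2l.
pose c := Num.max a (x - f); pose d := Num.min b (x + f).
apply: (@lt_le_trans _ _ (uniform_prob ab `[c, d])).
  apply: uniform_prob_itv_gt0; rewrite /c /d.
  - by rewrite le_max lexx.
  - have xf1 : x - f < x by rewrite ltrBlDr ltrDl.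
    have xf2 : x < x + f by rewrite ltrDl.
    by rewrite gt_max !lt_min ab (le_lt_trans ax xf2) (lt_le_trans xf1 xb)
               (lt_trans xf1 xf2).
  - by rewrite ge_min lexx.
apply: le_measure; rewrite ?inE//.
move=> y /=; rewrite in_itv/= /c /d ge_max le_min.
move=> /andP[/andP[_ ?] /andP[_ ?]].
by apply: fU; apply/andP; split.
Qed.

Lemma uniform_prob_set1 (x : R) : uniform_prob ab [set x] = 0%E.
Proof.
apply: (null_content_dominatesP _ _).1 (dominates_uniform_prob ab) _ _ _ => //.
exact: lebesgue_measure_set1.
Qed.
End uniform_support.

(** * Monic orthogonal polynomials and recursion coefficients *)

Section monic_orthogonal.
Context {R : realType}.
Implicit Types (p r : {poly R}) (ell : {poly R} -> R).
Implicit Types (q : nat -> {poly R}) (h : nat -> R).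

(** The measure enters only through its functional [ell], and the bilinear form
is [ell (p * r)]; [h n] is the squared norm of [q n]. Monic polynomials avoid
square roots, and the recursion coefficients are rational in this data up to a
final square root. *)
Definition monic_orthogonal ell q h :=
  [/\ forall n, q n \is monic, forall n, size (q n) = n.+1,
      forall m n, ell (q m * q n) = if m == n then h n else 0 &
      forall n, 0 < h n].

Definition subleading q n : R := if n is m.+1 then (q n)`_m else 0.

Lemma lin_ell0 ell : scalar ell -> ell 0 = 0.
Proof. by move=> L; have := L (-1) 0 0; rewrite scaler0 addr0 mulN1r addNr. Qed.

Lemma lin_ellD ell p r : scalar ell -> ell (p + r) = ell p + ell r.
Proof. by move=> L; have := L 1 p r; rewrite scale1r mul1r. Qed.

Lemma lin_ellB ell p r : scalar ell -> ell (p - r) = ell p - ell r.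
Proof. by move=> L; rewrite -[- r]scaleN1r addrC L mulN1r addrC. Qed.

Lemma lin_ellZ ell c p : scalar ell -> ell (c *: p) = c * ell p.
Proof. by move=> L; have := L c p 0; rewrite (lin_ell0 L) !addr0. Qed.

Lemma lin_ellMl ell c p r : scalar ell -> ell (c *: p * r) = c * ell (p * r).
Proof. by move=> L; rewrite -scalerAl lin_ellZ. Qed.

Lemma lin_ellMr ell c p r : scalar ell -> ell (p * (c *: r)) = c * ell (p * r).
Proof. by move=> L; rewrite -scalerAr lin_ellZ. Qed.

Lemma lin_ell_sum ell n (F : 'I_n -> {poly R}) : scalar ell ->
  ell (\sum_(i < n) F i) = \sum_(i < n) ell (F i).
Proof.
move=> L; elim/big_rec2: _ => [|i _ y _ <-]; [exact: lin_ell0|exact: lin_ellD].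
Qed.

Section system.
Variables (ell : {poly R} -> R) (q : nat -> {poly R}) (h : nat -> R).
Hypotheses (lin : scalar ell) (mo : monic_orthogonal ell q h).

Lemma mo_monic n : q n \is monic. Proof. by case: mo. Qed.
Lemma mo_size n : size (q n) = n.+1. Proof. by case: mo. Qed.
Lemma mo_dot m n : ell (q m * q n) = if m == n then h n else 0.
Proof. by case: mo. Qed.
Lemma mo_gt0 n : 0 < h n. Proof. by case: mo. Qed.
Lemma mo_lead n : (q n)`_n = 1.
Proof. by have /monicP := mo_monic n; rewrite lead_coefE mo_size. Qed.

Lemma orthogonal_expansion n p : (size p <= n)%N ->
  p = \sum_(k < n) (ell (p * q k) / h k) *: q k.
Proof.
elim: n p => [p|n IHn p sp].
  by rewrite leqn0 size_poly_eq0 big_ord0 => /eqP.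
pose r := p - p`_n *: q n.
have sr : (size r <= n)%N.
  apply/leq_sizeP => j; rewrite leq_eqVlt => /predU1P[<-|nj].
    by rewrite coefB coefZ mo_lead mulr1 subrr.
  rewrite coefB coefZ (nth_default _ (leq_trans sp nj)).
  by rewrite (@nth_default _ _ (q n) j) ?mo_size// mulr0 subr0.
have pE : p = r + p`_n *: q n by rewrite subrK.
have pk k : ell (p * q k) = ell (r * q k) + p`_n * (if n == k then h k else 0).
  by rewrite [in LHS]pE mulrDl (lin_ellD _ _ lin) (lin_ellMl _ _ _ lin) mo_dot.
have rn : ell (r * q n) = 0.
  rewrite (IHn _ sr) mulr_suml lin_ell_sum// big1// => i _.
  by rewrite (lin_ellMl _ _ _ lin) mo_dot ltn_eqF ?mulr0.
rewrite big_ord_recr/= pk eqxx rn add0r mulfK ?gt_eqF ?mo_gt0//.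
rewrite {1}pE {1}(IHn _ sr); congr (_ + _); apply: eq_bigr => i _.
by rewrite pk gtn_eqF ?mulr0 ?addr0.
Qed.

Lemma orthogonal_lower n p : (size p <= n)%N -> ell (q n * p) = 0.
Proof.
move=> /orthogonal_expansion ->; rewrite mulr_sumr lin_ell_sum// big1// => i _.
by rewrite (lin_ellMr _ _ _ lin) mo_dot gtn_eqF ?mulr0.
Qed.

Lemma size_monic_sub n p : p \is monic -> size p = n.+1 ->
  (size (p - q n)%R <= n)%N.
Proof.
move=> /monicP; rewrite lead_coefE => pm sp; apply/leq_sizeP => j.
rewrite leq_eqVlt => /predU1P[<-|nj].
  by rewrite coefB mo_lead; move: pm; rewrite sp => ->; rewrite subrr.
by rewrite coefB !nth_default ?subr0 ?mo_size// sp.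
Qed.

Lemma orthogonal_monic n p : p \is monic -> size p = n.+1 ->
  ell (q n * p) = h n.
Proof.
move=> mp sp; rewrite -(subrK (q n) p) mulrDr (lin_ellD _ _ lin) mo_dot eqxx.
by rewrite orthogonal_lower ?add0r// size_monic_sub.
Qed.

(** The two top coefficients of [r], the difference of the two sides, cancel by
the choice of the coefficient of [q n], and [r] is orthogonal to every [q k]
with [k < n] because [ell ('X * q n * q k) = ell (q n * ('X * q k))]; so [r]
vanishes. Reading the middle coefficient off the subleading coefficients, rather
than as [ell ('X * q n ^+ 2) / h n], is what makes its change under a point mass
a difference of consecutive terms of one sequence. *)
Lemma monic_recursion n :
  'X * q n = q n.+1 + (subleading q n - subleading q n.+1) *: q n
             + (if n is m.+1 then (h n / h m) *: q m else 0).
Proof.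
set t : {poly R} := (if n is m.+1 then _ else _); set b := (_ - _).
pose r := 'X * q n - q n.+1 - b *: q n - t.
suff r0 : r = 0 by apply/eqP; rewrite -subr_eq0 -r0 /r !opprD !addrA.
have st : (size t <= n)%N.
  rewrite /t; case: (n) => [|m]; first by rewrite size_poly0.
  by rewrite (leq_trans (size_scale_leq _ _))// mo_size.
have sr : (size r <= n)%N.
  apply/leq_sizeP => j; rewrite leq_eqVlt => /predU1P[<-|].
    rewrite /r !coefB coefZ mo_lead (nth_default _ st) coefXM.
    rewrite /b /subleading; case: (n) => [|m] /=; ring.
  rewrite leq_eqVlt => /predU1P[<-|nj].
    rewrite /r !coefB coefZ coefXM /= !mo_lead subrr.
    rewrite !nth_default ?mulr0 ?subr0 ?mo_size//.
    exact: leq_trans st _.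
  rewrite /r !coefB coefZ coefXM !nth_default ?mulr0 ?subr0 ?mo_size ?if_same//.
  - by apply: (leq_trans st); rewrite -ltnS ltnW// ltnW.
  - exact: ltnW.
  - by case: j nj.
rewrite (orthogonal_expansion sr) big1// => -[k /= kn] _.
suff -> : ell (r * q k) = 0 by rewrite mul0r scale0r.
have -> : r * q k =
    q n * ('X * q k) - q n.+1 * q k - b *: (q n * q k) - t * q k.
  by rewrite /r !mulrBl -scalerAl mulrA [q n * 'X]mulrC.
rewrite lin_ellB// lin_ellB// lin_ellB// lin_ellZ// !mo_dot.
rewrite (gtn_eqF kn) (gtn_eqF (ltnW kn : k < n.+1)%N) mulr0 !subr0.
have sX : size ('X * q k) = k.+2.
  by rewrite mulrC size_mulX ?mo_size// -size_poly_eq0 mo_size.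
have mX : 'X * q k \is monic by rewrite monicMr ?monicX ?mo_monic.
rewrite /t; case: (n) kn sX mX => //= m; rewrite ltnS leq_eqVlt.
move=> /predU1P[-> sX mX|km sX mX].
  rewrite orthogonal_monic// (lin_ellMl _ _ _ lin) mo_dot eqxx.
  by rewrite divfK ?subrr// gt_eqF ?mo_gt0.
rewrite orthogonal_lower ?sX// (lin_ellMl _ _ _ lin) mo_dot gtn_eqF//.
by rewrite mulr0 subr0.
Qed.

(** The predecessors make these the recursion coefficients numbered from 1;
the values at 0 are junk. *)
Definition jacobi_a n := Num.sqrt (h n / h n.-1).
Definition jacobi_b n := subleading q n.-1 - subleading q n.

Section gram_schmidt.
Variable mu : {measure set (measurableTypeR R) -> \bar R}.
Hypothesis muE : forall p r, L2dot mu p r = ell (p * r).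

(** The unnormalized vector of the Gram--Schmidt step is ['X^n] minus its
projection on the lower [q k]; as ['X^n - q n] has degree less than [n], it
equals that projection. *)
Lemma gram_schmidtE n :
  gram_schmidt mu n = mkseq (fun k => (Num.sqrt (h k))^-1 *: q k) n.
Proof.
elim: n => // n IHn; rewrite /= IHn mkseqS; congr rcons.
set u := 'X^n - _.
suff -> : u = q n by rewrite muE mo_dot eqxx.
have sX : (size ('X^n - q n)%R <= n)%N.
  by rewrite size_monic_sub ?monicXn// size_polyXn.
rewrite /u big_map -{2}[n]subn0 big_mkord; apply/eqP.
rewrite subr_eq addrC -subr_eq; apply/eqP.
rewrite (orthogonal_expansion sX); apply: eq_bigr => k _.
rewrite muE (lin_ellMr _ _ _ lin) scalerA; congr (_ *: _).
rewrite mulrBl lin_ellB// mo_dot gtn_eqF// subr0 mulrAC -invfM -expr2.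
by rewrite sqr_sqrtr 1?ltW ?mo_gt0// mulrC.
Qed.

Lemma orthonormal_polyE n :
  orthonormal_poly mu n = (Num.sqrt (h n))^-1 *: q n.
Proof. by rewrite /orthonormal_poly gram_schmidtE nth_mkseq. Qed.

Lemma recursion_coefs_jacobi : recursion_coefs mu jacobi_a jacobi_b.
Proof.
have s0 n : Num.sqrt (h n) != 0 by rewrite gt_eqF ?sqrtr_gt0 ?mo_gt0.
have ss n : h n = Num.sqrt (h n) ^+ 2 by rewrite sqr_sqrtr 1?ltW ?mo_gt0.
have aE n : jacobi_a n = Num.sqrt (h n) / Num.sqrt (h n.-1).
  by rewrite /jacobi_a sqrtrM ?sqrtrV 1?ltW ?mo_gt0.
split=> [n _|n]; first by rewrite sqrtr_gt0 divr_gt0 ?mo_gt0.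
rewrite !orthonormal_polyE -scalerAr monic_recursion !scalerDr !scalerA.
congr (_ + _ + _).
- by congr (_ *: _); rewrite aE /=; field; rewrite !s0.
- by congr (_ *: _); rewrite mulrC.
- case: n => [|n]; first by rewrite !scaler0.
  rewrite orthonormal_polyE !scalerA; congr (_ *: _).
  have -> : h n.+1 / h n = (Num.sqrt (h n.+1) / Num.sqrt (h n)) ^+ 2.
    by rewrite expr_div_n -!ss.
  by rewrite aE /=; field; rewrite !s0.
Qed.

End gram_schmidt.

End system.

(** * Adding a point mass *)

Section point_mass.
Variables (ell : {poly R} -> R) (q : nat -> {poly R}) (h : nat -> R).
Hypotheses (lin : scalar ell) (mo : monic_orthogonal ell q h).
Variables (x0 lam : R) (lam_gt0 : 0 < lam).

(** [cd_kernel n] is the Christoffel--Darboux kernel with one argument fixed at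
[x0], and [cd_diag n] is its value at [x0]. The monic polynomials for the
functional with mass [lam] at [x0] are obtained from [q n] by subtracting the
multiple [mass_coef n] of the kernel. *)
Definition cd_diag n := \sum_(k < n) (q k).[x0] ^+ 2 / h k.
Definition mass_factor n := 1 + lam * cd_diag n.
Definition cd_kernel n := \sum_(k < n) ((q k).[x0] / h k) *: q k.
Definition mass_coef n := lam * (q n).[x0] / mass_factor n.
Definition mass_poly n := q n - mass_coef n *: cd_kernel n.
Definition mass_ell p := ell p + lam * p.[x0].
Definition mass_h n := h n * mass_factor n.+1 / mass_factor n.

Lemma mass_factor_gt0 n : 0 < mass_factor n.
Proof.
rewrite ltr_wpDr// mulr_ge0 ?(ltW lam_gt0)//; apply: sumr_ge0 => k _.
by rewrite divr_ge0 ?sqr_ge0 ?ltW ?(mo_gt0 mo).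
Qed.

Lemma mass_factorS n :
  mass_factor n.+1 = mass_factor n + lam * ((q n).[x0] ^+ 2 / h n).
Proof. by rewrite /mass_factor /cd_diag big_ord_recr /= mulrDr addrA. Qed.

Lemma cd_kernel_reproducing n p : (size p <= n)%N ->
  ell (cd_kernel n * p) = p.[x0].
Proof.
move=> sp; rewrite [in RHS](orthogonal_expansion lin mo sp) horner_sum.
rewrite /cd_kernel mulr_suml lin_ell_sum//; apply: eq_bigr => k _.
by rewrite (lin_ellMl _ _ _ lin) hornerZ [p * _]mulrC; ring.
Qed.

Lemma size_cd_kernel n : (size (cd_kernel n) <= n)%N.
Proof.
apply: (leq_trans (size_sum _ _ _)); apply/bigmax_leqP => k _.
by rewrite (leq_trans (size_scale_leq _ _))// (mo_size mo).
Qed.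

Lemma size_mass_tail n : (size (mass_coef n *: cd_kernel n) < size (q n))%N.
Proof.
by rewrite (mo_size mo) ltnS (leq_trans (size_scale_leq _ _))// size_cd_kernel.
Qed.

Lemma mass_poly_monic n : mass_poly n \is monic.
Proof.
rewrite monicE lead_coefDl ?size_polyN ?size_mass_tail//.
by rewrite -monicE (mo_monic mo).
Qed.

Lemma size_mass_poly n : size (mass_poly n) = n.+1.
Proof. by rewrite size_polyDl ?size_polyN ?size_mass_tail// (mo_size mo). Qed.

Lemma horner_mass_poly n : lam * (mass_poly n).[x0] = mass_coef n.
Proof.
have -> : (mass_poly n).[x0] = (q n).[x0] - mass_coef n * cd_diag n.
  rewrite hornerD hornerN hornerZ horner_sum; congr (_ - _ * _).
  by apply: eq_bigr => k _; rewrite hornerZ expr2 mulrAC.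
have Dn := mass_factor_gt0 n.
have : mass_coef n * mass_factor n = lam * (q n).[x0] by rewrite divfK ?gt_eqF.
by rewrite /mass_factor mulrBr => <-; ring.
Qed.

Lemma mass_ell_scalar : scalar mass_ell.
Proof. by move=> c p r; rewrite /mass_ell lin hornerD hornerZ /=; ring. Qed.

(** On polynomials of lower degree the kernel acts as evaluation at [x0], so its
multiple [mass_coef n] cancels the contribution of the point mass. *)
Lemma mass_poly_orthogonal n p : (size p <= n)%N ->
  mass_ell (mass_poly n * p) = 0.
Proof.
move=> sp; rewrite /mass_ell hornerM mulrA horner_mass_poly.
rewrite mulrBl lin_ellB// (orthogonal_lower lin mo sp) (lin_ellMl _ _ _ lin).
by rewrite cd_kernel_reproducing// sub0r addNr.
Qed.

Lemma mass_poly_norm n : mass_ell (mass_poly n * mass_poly n) = mass_h n.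
Proof.
have -> : mass_poly n * mass_poly n =
    mass_poly n * q n - mass_coef n *: (mass_poly n * cd_kernel n).
  by rewrite {2}/mass_poly mulrBr -scalerAr.
rewrite (lin_ellB _ _ mass_ell_scalar) (lin_ellZ _ _ mass_ell_scalar).
rewrite (mass_poly_orthogonal (size_cd_kernel n)) mulr0 subr0.
rewrite /mass_ell hornerM mulrA horner_mass_poly.
rewrite mulrBl lin_ellB// (mo_dot mo) eqxx (lin_ellMl _ _ _ lin).
rewrite [cd_kernel n * _]mulrC.
rewrite (orthogonal_lower lin mo (size_cd_kernel n)).
rewrite mulr0 subr0 /mass_h mass_factorS /mass_coef.
have Dn := mass_factor_gt0 n; have hn := mo_gt0 mo n.
by field; rewrite !gt_eqF.
Qed.

Lemma mass_monic_orthogonal : monic_orthogonal mass_ell mass_poly mass_h.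
Proof.
split=> [n|n|m n|n]; first exact: mass_poly_monic.
- exact: size_mass_poly.
- case: ltngtP => [mn|nm|->]; last exact: mass_poly_norm.
    by rewrite mulrC mass_poly_orthogonal// size_mass_poly.
  by rewrite mass_poly_orthogonal// size_mass_poly.
- by rewrite divr_gt0 ?mulr_gt0 ?mass_factor_gt0 ?(mo_gt0 mo).
Qed.

(** Only the last term of the kernel has degree [n], and its leading coefficient
is [(q n).[x0] / h n]. *)
Lemma subleading_mass_poly n :
  subleading mass_poly n.+1 =
  subleading q n.+1 -
  lam * (q n).[x0] * (q n.+1).[x0] / (h n * mass_factor n.+1).
Proof.
rewrite /subleading coefB coefZ; congr (_ - _).
rewrite coef_sum big_ord_recr /= big1 ?add0r; last first.
  by move=> k _; rewrite coefZ nth_default ?mulr0// (mo_size mo).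
rewrite coefZ (mo_lead mo) /mass_coef.
have Dn := mass_factor_gt0 n.+1; have hn := mo_gt0 mo n.
by field; rewrite !gt_eqF.
Qed.

End point_mass.

Section scaling.
Variables (ell : {poly R} -> R) (q : nat -> {poly R}) (h : nat -> R).

Lemma monic_orthogonal_scale (c : R) : 0 < c -> monic_orthogonal ell q h ->
  monic_orthogonal (fun p => c * ell p) q (fun n => c * h n).
Proof.
move=> c0 [m s o g]; split => // [i j|n]; last by rewrite mulr_gt0.
by rewrite o; case: eqP => _; rewrite ?mulr0.
Qed.

End scaling.

(** * Orthogonality from a three-term recursion *)

Section favard.
Variables (ell : {poly R} -> R) (q : nat -> {poly R}) (al : nat -> R).
Hypotheses (lin : scalar ell) (ell1 : ell 1 = 1).
Hypothesis q0 : q 0 = 1.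
Hypothesis qS : forall n,
  q n.+1 = 'X * q n - (if n is m.+1 then al n *: q m else 0).
Hypothesis al_gt0 : forall n, 0 < al n.+1.
Hypothesis ellq : forall n, ell (q n.+1) = 0.

(** This is the easy half of Favard's theorem: since ['X] can be moved from one
factor to the other, the recursion reduces every [ell (q m * q n)] with [m < n]
to values [ell (q k)] with [k > 0], and the norms to [ell 1]. *)
Lemma favard : monic_orthogonal ell q (fun n => \prod_(1 <= k < n.+1) al k).
Proof.
have qX n : 'X * q n = q n.+1 + (if n is m.+1 then al n *: q m else 0).
  by rewrite qS subrK.
have ms n : q n \is monic /\ size (q n) = n.+1.
  suff [] : (q n \is monic /\ size (q n) = n.+1) /\
            (q n.+1 \is monic /\ size (q n.+1) = n.+2) by [].
  elim: n => [|n [[m1 s1] [m2 s2]]].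
    by rewrite qS q0 subr0 mulr1 size_poly1 monic1 monicX size_polyX.
  split=> //; have sX : size ('X * q n.+1) = n.+3.
    by rewrite mulrC size_mulX ?s2// -size_poly_eq0 s2.
  have st : (size (- (al n.+1 *: q n))%R < size ('X * q n.+1)%R)%N.
    by rewrite size_polyN sX ltnS (leq_trans (size_scale_leq _ _))// s1.
  rewrite qS size_polyDl// monicE lead_coefDl// -monicE.
  by rewrite rpredM ?monicX.
have orth m : forall n, (m < n)%N -> ell (q m * q n) = 0.
  elim/ltn_ind: m => -[_|m IH] n.
    by case: n => // n _; rewrite q0 mul1r ellq.
  case: n => // n; rewrite ltnS => mn.
  rewrite [q m.+1]qS mulrBl lin_ellB// mulrAC qX mulrC mulrDr.
  rewrite (lin_ellD _ _ lin).
  rewrite IH ?(leqW (leqW mn))// (lin_ellMr _ _ _ lin) IH// mulr0 !add0r.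
  case: m IH mn => [|m] IH mn; first by rewrite mul0r (lin_ell0 lin) oppr0.
  by rewrite (lin_ellMl _ _ _ lin) IH ?mulr0 ?oppr0// ltnW// ltnW// ltnW.
have norm n : ell (q n * q n) = \prod_(1 <= k < n.+1) al k.
  elim: n => [|n IH]; first by rewrite big_geq// q0 mulr1.
  rewrite [q n.+1 in X in ell (X * _)]qS mulrBl lin_ellB// mulrAC qX.
  rewrite mulrDl (lin_ellD _ _ lin) [q n.+2 * _]mulrC orth// add0r.
  rewrite (lin_ellMl _ _ _ lin) IH [in RHS]big_nat_recr//= mulrC.
  case: (n) => [|m]; first by rewrite mul0r (lin_ell0 lin) subr0.
  by rewrite (lin_ellMl _ _ _ lin) orth ?mulr0 ?subr0.
split=> [n|n|m n|n]; [by have [] := ms n|by have [] := ms n| |].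
- case: ltngtP => [mn|nm|->]; [exact: orth|by rewrite mulrC orth|exact: norm].
- by rewrite big_nat_cond prodr_gt0// => -[|k].
Qed.

End favard.
End monic_orthogonal.

(** * Legendre polynomials on [[-2, 2]] *)

Section legendre.
Context {R : realType}.

(** The squares of the recursion coefficients of the Legendre polynomials,
rescaled from [[-1, 1]] to [[-2, 2]]. *)
Definition legendre_alpha n : R := 4 * n%:R ^+ 2 / (4 * n%:R ^+ 2 - 1).

(** The recursion has two steps, so that consecutive polynomials are computed
together. *)
Fixpoint legendre_pair n : {poly R} * {poly R} :=
  if n is m.+1 then
    let: (p, r) := legendre_pair m in (r, 'X * r - legendre_alpha m.+1 *: p)
  else (1, 'X).
Definition legendre n := (legendre_pair n).1.

Lemma legendre0 : legendre 0 = 1. Proof. by []. Qed.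

Lemma legendreS n : legendre n.+1 =
  'X * legendre n - (if n is m.+1 then legendre_alpha n *: legendre m else 0).
Proof.
have pE m : (legendre_pair m).2 = legendre m.+1.
  by rewrite /legendre /=; case: (legendre_pair m).
case: n => [|n]; first by rewrite legendre0 mulr1 subr0.
rewrite -pE /= -pE /legendre.
by case: (legendre_pair n).
Qed.

Lemma legendreSS n : legendre n.+2 =
  'X * legendre n.+1 - legendre_alpha n.+1 *: legendre n.
Proof. exact: legendreS. Qed.

Lemma odd_neq0 n : (2 * n%:R + 1 : R) != 0.
Proof. by rewrite gt_eqF// ltr_wpDl// mulr_ge0. Qed.

Lemma legendre_alphaS n :
  legendre_alpha n.+1 = 4 * n.+1%:R ^+ 2 / ((2 * n%:R + 1) * (2 * n.+1%:R + 1)).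
Proof. by rewrite /legendre_alpha -natr1; congr (_ / _); ring. Qed.

Lemma legendre_alpha_gt0 n : 0 < legendre_alpha n.+1.
Proof.
by rewrite legendre_alphaS divr_gt0// ?mulr_gt0// ?ltr_wpDl// mulr_ge0.
Qed.

(** For the classical polynomials [P_n] these are
[P'_(n+1) = x P'_n + (n+1) P_n] and [x P'_(n+1) - P'_n = (n+1) P_(n+1)]. Neither
passes from [n] to [n+1] alone, but together they do. *)
Lemma legendre_derivs n (x : R) :
  (2 * n%:R + 1) * (legendre n.+1)^`().[x] =
     n.+1%:R * (x * (legendre n)^`().[x] + n.+1%:R * (legendre n).[x]) /\
  (2 * n%:R + 1) *
      (x * (legendre n.+1)^`().[x] - n.+1%:R * (legendre n.+1).[x]) =
     4 * n.+1%:R * (legendre n)^`().[x].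
Proof.
elim: n => [|n [B C]].
  rewrite legendreS legendre0 subr0 mulr1 derivX derivC !hornerE; split; ring.
have n1 := odd_neq0 n; have n2 := odd_neq0 n.+1.
have SE : (n.+2%:R : R) = n%:R + 2 by rewrite -addn2 natrD.
have nE : (n.+1%:R : R) = n%:R + 1 by rewrite -natr1.
have n0 : (n%:R + 1 : R) != 0 by rewrite gt_eqF// ltr_wpDl.
rewrite legendreSS derivB derivZ derivM derivX mul1r !hornerE legendre_alphaS.
move: n0 n1 n2 B C; rewrite SE nE.
set d1 := (legendre n.+1)^`().[x]; set d0 := (legendre n)^`().[x].
set v1 := (legendre n.+1).[x]; set v0 := (legendre n).[x]; set k : R := n%:R.
move=> n0 n1 n2 B C.
have d0E : d0 = (2 * k + 1) * (x * d1 - (k + 1) * v1) / (4 * (k + 1)).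
  by rewrite C; field; rewrite n0.
split.
  rewrite d0E; field.
  by rewrite n1 n2 n0.
have v0E : (k + 1) * ((k + 1) * v0) = (2 * k + 1) * d1 - (k + 1) * (x * d0).
  by rewrite B; ring.
have -> : v0 = ((2 * k + 1) * d1 - (k + 1) * (x * d0)) / ((k + 1) * (k + 1)).
  by rewrite -v0E; field.
rewrite d0E; field; rewrite n1 n2 n0//.
Qed.

(** This corresponds to [(2n+1) P_n = (P_(n+1) - P_(n-1))']. Its interest is that
the antiderivative vanishes at both endpoints, so that [legendre n.+1] has
integral zero. *)
Definition legendre_primitive n : {poly R} := legendre n.+2 -
  (4 * n.+1%:R * n.+2%:R / ((2 * n%:R + 1) * (2 * n.+1%:R + 1))) *: legendre n.

Lemma legendre_antideriv n (x : R) :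
  n.+2%:R * (legendre n.+1).[x] = (legendre_primitive n)^`().[x].
Proof.
have [_ C] := legendre_derivs n x; have [B _] := legendre_derivs n.+1 x.
have n1 := odd_neq0 n; have n2 := odd_neq0 n.+1.
rewrite /legendre_primitive derivB derivZ !hornerE.
have -> : (legendre n.+2)^`().[x] = n.+2%:R *
    (x * (legendre n.+1)^`().[x] + n.+2%:R * (legendre n.+1).[x]) /
    (2 * n.+1%:R + 1).
  by rewrite -B; field.
have -> : 4 * n.+1%:R * n.+2%:R / ((2 * n%:R + 1) * (2 * n.+1%:R + 1)) *
      (legendre n)^`().[x] =
    n.+2%:R / ((2 * n%:R + 1) * (2 * n.+1%:R + 1)) *
      (4 * n.+1%:R * (legendre n)^`().[x]) by ring.
have SE : (n.+2%:R : R) = n%:R + 2 by rewrite -addn2 natrD.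
have nE : (n.+1%:R : R) = n%:R + 1 by rewrite -natr1.
rewrite -C; move: n1 n2; rewrite SE nE => n1 n2.
by field; rewrite n1 n2.
Qed.

(** The classical normalization [P_n(1) = 1], in terms of the ratio of leading
coefficients. *)
Lemma legendre_at2 n :
  (2 * n%:R + 1) * (legendre n.+1).[2] = 2 * n.+1%:R * (legendre n).[2].
Proof.
elim: n => [|n IH].
  by rewrite legendreS legendre0 subr0 mulr1 !hornerE; ring.
have n1 := odd_neq0 n; have n2 := odd_neq0 n.+1.
have n0 : (n%:R + 1 : R) != 0 by rewrite gt_eqF// ltr_wpDl.
rewrite legendreSS !hornerE legendre_alphaS.
have SE : (n.+2%:R : R) = n%:R + 2 by rewrite -addn2 natrD.
have nE : (n.+1%:R : R) = n%:R + 1 by rewrite -natr1.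
move: IH n1 n2; rewrite SE nE => IH n1 n2.
have -> : (legendre n).[2] =
    (2 * n%:R + 1) * (legendre n.+1).[2] / (2 * (n%:R + 1)).
  by rewrite IH; field.
by field; rewrite n1 n2 n0.
Qed.

Lemma legendre_parity n (x : R) :
  (legendre n).[- x] = (-1) ^+ n * (legendre n).[x].
Proof.
elim/ltn_ind: n => -[_|[_|n IH]].
- rewrite legendre0 !hornerE; ring.
- by rewrite legendreS legendre0 subr0 mulr1 !hornerE; ring.
- by rewrite legendreSS !hornerE !IH// ?exprS; ring.
Qed.

Lemma legendre_primitive_at2 n : (legendre_primitive n).[2] = 0.
Proof.
have n1 := odd_neq0 n; have n2 := odd_neq0 n.+1.
have A := legendre_at2 n; have B := legendre_at2 n.+1.
rewrite !hornerE.
have -> : (legendre n.+2).[2] =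
    2 * n.+2%:R * (legendre n.+1).[2] / (2 * n.+1%:R + 1).
  by rewrite -B; field.
have -> : (legendre n.+1).[2] =
    2 * n.+1%:R * (legendre n).[2] / (2 * n%:R + 1).
  by rewrite -A; field.
by field; do ?[apply/andP; split].

Qed.

Lemma legendre_primitive_atN2 n : (legendre_primitive n).[- 2] = 0.
Proof.
have := legendre_primitive_at2 n; rewrite !hornerE !legendre_parity => E.
rewrite !exprS -[RHS](mulr0 ((-1) ^+ n)) -E; ring.
Qed.
Lemma legendre_alphaE n :
  legendre_alpha n.+1 = 1 + ((2 * n%:R + 1) * (2 * n%:R + 3))^-1.
Proof.
have n0 : 0 <= n%:R :> R by [].
rewrite legendre_alphaS -natr1; field.
by apply/andP; split; rewrite gt_eqF//; lra.
Qed.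

Lemma legendre_alpha_ge1 n : 1 <= legendre_alpha n.+1.
Proof.
have n0 : 0 <= n%:R :> R by [].
by rewrite legendre_alphaE lerDl invr_ge0 mulr_ge0//; lra.
Qed.

Lemma legendre_alpha_le2 n : legendre_alpha n.+1 <= 2.
Proof.
have n0 : 0 <= n%:R :> R by [].
have : ((2 * n%:R + 1) * (2 * n%:R + 3))^-1 <= 1 :> R.
  by rewrite invf_le1; nra.
by rewrite legendre_alphaE; lra.
Qed.

Lemma legendre_alphaB n : legendre_alpha n.+1 - legendre_alpha n.+2 =
  4 / ((2 * n%:R + 1) * (2 * n%:R + 3) * (2 * n%:R + 5)).
Proof.
have n0 : 0 <= n%:R :> R by [].
rewrite !legendre_alphaE -natr1; field.
by do ?[apply/andP; split]; rewrite gt_eqF//; lra.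
Qed.

Lemma legendre_alpha_decr n : legendre_alpha n.+2 <= legendre_alpha n.+1.
Proof.
have n0 : 0 <= n%:R :> R by [].
by rewrite -subr_ge0 legendre_alphaB divr_ge0// !mulr_ge0//; lra.
Qed.

End legendre.

(** * Exponential decay *)

Section exp_decay_theory.
Context {R : realType}.
Implicit Types (u v : nat -> R).

Lemma exp_decay_le M u v : exp_decay u ->
  (forall n, (1 <= n)%N -> `|v n| <= M * `|u n|) -> exp_decay v.
Proof.
move=> [C [c [C0 c0 uC]]] vu.
exists ((`|M| + 1) * C), c; split => //; first by rewrite mulr_gt0// ltr_wpDl.
move=> n n1; rewrite (le_trans (vu _ n1))// -mulrA.
rewrite (le_trans (ler_wpM2r (normr_ge0 _) (ler_norm M)))//.
by rewrite ler_pM// ?lerDl// uC.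
Qed.

Lemma exp_decayN u : exp_decay u -> exp_decay (fun n => - u n).
Proof.
move=> uC; apply: (exp_decay_le (M := 1) uC) => n _.
by rewrite normrN mul1r.
Qed.

Lemma exp_decayM M u v : exp_decay u -> (forall n, (1 <= n)%N -> `|v n| <= M) ->
  exp_decay (fun n => v n * u n).
Proof.
move=> uC vM; apply: (exp_decay_le (M := M) uC) => n n1.
by rewrite normrM ler_wpM2r// vM.
Qed.

Lemma exp_decayD u v : exp_decay u -> exp_decay v ->
  exp_decay (fun n => u n + v n).
Proof.
move=> [C [c [C0 c0 uC]]] [D [d [D0 d0 vD]]].
exists (C + D), (Num.min c d); split=> [||n n1]; first by rewrite addr_gt0.
  by rewrite lt_min c0.
rewrite (le_trans (ler_normD _ _))// mulrDl lerD//.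
- rewrite (le_trans (uC _ n1))// ler_wpM2l ?ler_expR ?lerN2 ?ler_wpM2r
    ?ge_min ?lexx//.
  exact: ltW.
- rewrite (le_trans (vD _ n1))// ler_wpM2l ?ler_expR ?lerN2 ?ler_wpM2r
    ?ge_min ?lexx ?orbT//.
  exact: ltW.
Qed.

Lemma exp_decayB u v : exp_decay u -> exp_decay v ->
  exp_decay (fun n => u n - v n).
Proof. by move=> uC vC; apply: exp_decayD => //; exact: exp_decayN. Qed.

Lemma exp_decayS u : exp_decay u -> exp_decay (fun n => u n.+1).
Proof.
move=> [C [c [C0 c0 uC]]]; exists C, c; split => // n n1.
rewrite (le_trans (uC _ _))// ler_wpM2l ?(ltW C0)// ler_expR lerN2.
by rewrite ler_wpM2l ?(ltW c0)// ler_nat.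
Qed.

Lemma exp_decay_pred u : exp_decay (fun n => u n.+1) -> exp_decay u.
Proof.
move=> [C [c [C0 c0 uC]]]; exists ((C + `|u 1|) * expR c), c; split => //.
  by rewrite mulr_gt0 ?expR_gt0// ltr_pwDl.
move=> [//|n] _; rewrite -mulrA -expRD -natr1 mulrDr mulr1 opprD addrCA subrr
  addr0.
case: n => [|n]; first by rewrite mulr0 oppr0 expR0 mulr1 lerDr ltW.
by rewrite (le_trans (uC _ _))// ler_wpM2r ?expR_ge0// lerDl.
Qed.

Lemma exp_decay_eq u v : (forall n, (1 <= n)%N -> u n = v n) ->
  exp_decay u -> exp_decay v.
Proof.
move=> uv uC; apply: (exp_decay_le (M := 1) uC) => n n1.
by rewrite uv// mul1r.
Qed.

Lemma exp_decay_bounded u : exp_decay u ->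
  exists2 C, 0 < C & forall n, (1 <= n)%N -> `|u n| <= C.
Proof.
move=> [C [c [C0 c0 uC]]]; exists C => // n n1.
rewrite (le_trans (uC _ n1))// ger_pMr// -expR0 ler_expR oppr_le0.
by rewrite mulr_ge0 ?(ltW c0).
Qed.

(** An exponential beats any power: [expR (c * n) >= (c * n / 4) ^+ 4], which
outgrows the cube. *)
Lemma not_exp_decay_cube (k : R) u : 0 < k ->
  (forall n, (1 <= n)%N -> k <= u n * n%:R ^+ 3) -> ~ exp_decay u.
Proof.
move=> k0 uk [C [c [C0 c0 uC]]].
pose d := c / 4; have d0 : 0 < d by rewrite divr_gt0.
have kd0 : 0 < k * d ^+ 4 by rewrite mulr_gt0// exprn_gt0.
have bound n : (1 <= n)%N -> n%:R * (k * d ^+ 4) <= C.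
  move=> n1; have n0 : 0 < (n%:R : R) by rewrite ltr0n.
  have en : (d * n%:R) ^+ 4 <= expR (c * n%:R).
    have -> : c * n%:R = 4 * (d * n%:R).
      by rewrite /d; field.
    rewrite expRM_natl; apply: lerXn2r; rewrite ?nnegrE ?expR_ge0//.
      by rewrite mulr_ge0// ltW.
    by rewrite (le_trans _ (expR_ge1Dx _))// ?lerDr.
  have un : u n * expR (c * n%:R) <= C.
    rewrite (le_trans (ler_wpM2r (expR_ge0 _) (ler_norm _)))//.
    rewrite (le_trans (ler_wpM2r (expR_ge0 _) (uC _ n1)))//.
    by rewrite -mulrA -expRD addNr expR0 mulr1.
  have u0 : 0 <= u n.
    rewrite -(pmulr_lge0 _ (exprn_gt0 3 n0)).
    exact: le_trans (ltW k0) (uk _ n1).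
  apply: le_trans un; apply: le_trans (ler_wpM2l u0 en).
  have -> : u n * (d * n%:R) ^+ 4 = (u n * n%:R ^+ 3) * (n%:R * d ^+ 4) by ring.
  have -> : n%:R * (k * d ^+ 4) = k * (n%:R * d ^+ 4) by ring.
  by rewrite ler_wpM2r ?uk// mulr_ge0// ltW// exprn_gt0.
have := bound (Num.truncn (C / (k * d ^+ 4))).+1 isT.
rewrite -ler_pdivlMr// => /(lt_le_trans (truncnS_gt _)).
by rewrite ltxx.
Qed.
(** Both contradictions below come from this polynomial rate of convergence of
the recursion coefficients. *)
Lemma not_exp_decay_alphaB :
  ~ exp_decay (fun n => legendre_alpha n.+1 - legendre_alpha n.+2 : R).
Proof.
apply: (@not_exp_decay_cube 105^-1) => // n n1.
have : 1 <= n%:R :> R by rewrite ler1n.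
rewrite legendre_alphaB; move: (n%:R : R) => k k1.
rewrite mulrAC ler_pdivlMr; last by rewrite !mulr_gt0//; lra.
have : (2 * k + 1) * (2 * k + 3) * (2 * k + 5) <= 105 * k ^+ 3.
  (* Each factor is bounded using 1 <= k. *)
  have -> : 105 * k ^+ 3 = (3 * k) * (5 * k) * (7 * k) by ring.
  by do ?[apply: ler_pM]; rewrite ?mulr_ge0//; lra.
have k30 : 0 <= k ^+ 3 by rewrite exprn_ge0//; lra.
lra.
Qed.

End exp_decay_theory.

(** * Values outside the support *)

Section asymptotics.
Context {R : realType}.
(* v n, h n and D n stand for the value at x of the monic Legendre polynomial of
   degree n, for its squared norm, and for the factor mass_factor n at x. *)
Variables (x lam : R) (v h D : nat -> R).
Local Notation al := (@legendre_alpha R).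
Hypotheses (x_gt2 : 2 < x) (lam_gt0 : 0 < lam).
Hypotheses (v0 : v 0 = 1) (v1 : v 1 = x).
Hypothesis vSS : forall n, v n.+2 = x * v n.+1 - al n.+1 * v n.
Hypotheses (h0 : h 0 = 1) (hS : forall n, h n.+1 = h n * al n.+1).
Hypotheses (D0 : D 0 = 1)
  (DS : forall n, D n.+1 = D n + lam * (v n ^+ 2 / h n)).

(* With p_n the orthonormal polynomials, w n is lam * p_n(x)^2 and D n is one
   plus lam times the diagonal Christoffel--Darboux kernel at x. *)
Let m n := v n.+1 / v n.
Let w n := lam * (v n ^+ 2 / h n).

Let x_gt0 : 0 < x. Proof. by apply: lt_trans x_gt2. Qed.

(** In the classical normalization this says that [P_(n+1)(y) >= y P_n(y)] for
[y = x / 2 > 1]: the values grow exponentially. *)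
Lemma value_growth n : 0 < v n /\ x * n.+1%:R * v n <= (2 * n%:R + 1) * v n.+1.
Proof.
elim: n => [|n [vn IH]]; first by rewrite v0 v1; split => //; lra.
have n0 : 0 <= n%:R :> R by [].
have vn1 : 0 < v n.+1.
  rewrite -(pmulr_rgt0 _ (_ : 0 < 2 * n%:R + 1)); last by lra.
  by apply: lt_le_trans IH; rewrite !mulr_gt0.
split => //; rewrite vSS legendre_alphaS.
move: IH; rewrite -[n.+2%:R]natr1 -natr1; move: (n%:R : R) n0 => k k0 IH.
have -> : (2 * (k + 1) + 1) * (x * v n.+1 -
    4 * (k + 1) ^+ 2 / ((2 * k + 1) * (2 * (k + 1) + 1)) * v n) =
    (2 * k + 3) * x * v n.+1 - 4 * (k + 1) / (2 * k + 1) * ((k + 1) * v n).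
  by field; do ?[apply/andP; split]; rewrite gt_eqF//; lra.
have E : (k + 1) * v n <= (2 * k + 1) * v n.+1 / x.
  by rewrite ler_pdivlMr//; lra.
have F : 4 * (k + 1) / (2 * k + 1) * ((k + 1) * v n) <=
    4 * (k + 1) / x * v n.+1.
  apply: (@le_trans _ _
    (4 * (k + 1) / (2 * k + 1) * ((2 * k + 1) * v n.+1 / x))).
    by apply: ler_wpM2l => //; rewrite divr_ge0//; lra.
  rewrite le_eqVlt; apply/orP; left; apply/eqP; field.
  by do ?[apply/andP; split]; rewrite gt_eqF//; lra.
have G : 4 * (k + 1) / x <= (k + 1) * x.
  rewrite ler_pdivrMr// -mulrA [4 * _]mulrC ler_wpM2l// ?addr_ge0//.
  by have := x_gt2; nra.
have H : 4 * (k + 1) / x * v n.+1 <= (k + 1) * x * v n.+1.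
  by rewrite ler_wpM2r// ltW.
lra.
Qed.

Lemma value_gt0 n : 0 < v n. Proof. by have [] := value_growth n. Qed.

Lemma sqnorm_gt0 n : 0 < h n.
Proof.
elim: n => [|n IH]; first by rewrite h0.
by rewrite hS mulr_gt0// legendre_alpha_gt0.
Qed.

Lemma increment_gt0 n : 0 < w n.
Proof. by rewrite /w mulr_gt0// divr_gt0 ?exprn_gt0 ?value_gt0 ?sqnorm_gt0. Qed.

Lemma factor_gt0 n : 0 < D n.
Proof.
elim: n => [|n IH]; first by rewrite D0.
by rewrite DS addr_gt0// increment_gt0.
Qed.

Lemma ratio_ge n : x * n.+1%:R / (2 * n%:R + 1) <= m n.
Proof.
have [vn IH] := value_growth n; rewrite ler_pdivlMr//.
by rewrite mulrAC ler_pdivrMr ?ltr_wpDl ?mulr_ge0// [leRHS]mulrC.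
Qed.

Lemma ratio_ge1 n : 1 <= m n.
Proof.
apply: le_trans (ratio_ge n); rewrite -natr1.
have n0 : 0 <= n%:R :> R by [].
have : 2 * (n%:R + 1) <= x * (n%:R + 1) by rewrite ler_wpM2r ?addr_ge0// ltW.
by rewrite ler_pdivlMr ?ltr_wpDl ?mulr_ge0//; lra.
Qed.

Lemma ratio_le n : m n <= x.
Proof.
rewrite ler_pdivrMr ?value_gt0//; case: n => [|n]; first by rewrite v0 v1 mulr1.
by rewrite vSS gerBl mulr_ge0 ?(ltW (value_gt0 _))// ltW ?legendre_alpha_gt0.
Qed.

Lemma ratio_riccati n : al n.+1 = m n * (x - m n.+1).
Proof.
rewrite /m vSS; have := value_gt0 n; have := value_gt0 n.+1 => a b.
by field; rewrite !gt_eqF.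
Qed.

Lemma increment_ratio n : w n.+1 / w n = m n ^+ 2 / al n.+1.
Proof.
rewrite /w /m hS.
have := value_gt0 n; have := sqnorm_gt0 n.
have := @legendre_alpha_gt0 R n => a b c.
by field; rewrite !gt_eqF.
Qed.

Lemma increment_ratio_ge n : x ^+ 2 / 4 <= w n.+1 / w n.
Proof.
have n0 : 0 <= n%:R :> R by [].
rewrite increment_ratio.
apply: (@le_trans _ _ ((x * n.+1%:R / (2 * n%:R + 1)) ^+ 2 / al n.+1));
  last first.
  rewrite ler_pM2r ?invr_gt0 ?legendre_alpha_gt0//.
  rewrite lerXn2r ?nnegrE ?ratio_ge//; last by rewrite (le_trans _ (ratio_ge1 n)).
  by rewrite divr_ge0 ?mulr_ge0 ?(ltW x_gt0)//; lra.
rewrite legendre_alphaS -[n.+1%:R]natr1; move: (n%:R : R) n0 => k k0.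
have -> : (x * (k + 1) / (2 * k + 1)) ^+ 2 /
    (4 * (k + 1) ^+ 2 / ((2 * k + 1) * (2 * (k + 1) + 1))) =
    x ^+ 2 / 4 * ((2 * k + 3) / (2 * k + 1)).
  by field; do ?[apply/andP; split]; rewrite gt_eqF//; lra.
by rewrite ler_peMr ?divr_ge0 ?sqr_ge0// ler_pdivlMr; lra.
Qed.

(** The increments [w n] of [D] grow geometrically, so that the last one
dominates the sum of the previous ones. *)
Lemma factor_le_increment : exists2 A, 0 < A & forall n, D n <= A * w n.
Proof.
have x2 := x_gt2; have y0 : 0 < x ^+ 2 / 4 - 1 by nra.
exists (lam^-1 + (x ^+ 2 / 4 - 1)^-1); first by rewrite addr_gt0 ?invr_gt0.
set A := _ + _; have A1 : 1 <= A * (x ^+ 2 / 4 - 1).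
  by rewrite mulrDl [X in _ + X]mulVf ?gt_eqF// lerDr mulr_ge0 ?invr_ge0 ?ltW.
have A0 : 0 < A by rewrite addr_gt0 ?invr_gt0.
elim=> [|n IH].
  rewrite D0 /w v0 h0 expr1n divr1 mulr1 mulrDl mulVf ?gt_eqF// lerDl.
  by rewrite mulr_ge0 ?invr_ge0 ?ltW.
rewrite DS -/(w n); apply: (@le_trans _ _ (A * (x ^+ 2 / 4 * w n))); last first.
  by rewrite ler_pM2l// -ler_pdivlMr ?increment_gt0// increment_ratio_ge.
have wn := increment_gt0 n.
have : 1 * w n <= A * (x ^+ 2 / 4 - 1) * w n by rewrite ler_wpM2r// ltW.
lra.
Qed.

(** The difference [e] of the second coefficients is that of consecutive terms
of [s]. By the recursion, [D n.+1 * s n] and [D n * s n.-1] are [m n * w n] and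
[(x - m n) * w n]; subtracting, [2 * m n - x] is [s n] up to a bounded multiple
of [e n]. If [e] decays, so do the increments of [m], hence those of
[legendre_alpha n.+1 = m n * (x - m n.+1)]. *)
Lemma b_perturbation_not_exp_decay :
  let s n := lam * v n * v n.+1 / (h n * D n.+1) in
  ~ exp_decay (fun n => s n - s n.-1).
Proof.
move=> s; set e := (fun n => _) => eC.
have [A A0 DA] := factor_le_increment.
have zA n : `|D n / w n| <= A.
  rewrite ger0_norm ?divr_ge0 ?(ltW (factor_gt0 _)) ?(ltW (increment_gt0 _))//.
  by rewrite ler_pdivrMr ?increment_gt0.
have key n : 2 * m n.+1 - x = s n.+1 + D n.+1 / w n.+1 * e n.+1.
  rewrite /e /s /= /m /w !(DS n.+1) (vSS n) !hS.
  have a := value_gt0 n; have b := value_gt0 n.+1; have c := sqnorm_gt0 n.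
  have d := @legendre_alpha_gt0 R n; have f := factor_gt0 n.+1.
  have g : 0 < D n.+1 * (h n * al n.+1) + lam * v n.+1 ^+ 2.
    exact: addr_gt0 (mulr_gt0 f (mulr_gt0 c d))
                    (mulr_gt0 lam_gt0 (exprn_gt0 2 b)).
  by field; do ?[apply/andP; split]; rewrite gt_eqF.
have e2 : exp_decay (fun n => e n.+2).
  by apply: (@exp_decayS _ (fun n => e n.+1)); exact: exp_decayS.
have mC : exp_decay (fun n => m n.+2 - m n.+1).
  apply: (@exp_decay_eq _ (fun n => 2^-1 * (e n.+2 +
      (D n.+2 / w n.+2 * e n.+2 - D n.+1 / w n.+1 * e n.+1)))).
    move=> n _; have k1 := key n; have k2 := key n.+1.
    have : e n.+2 = s n.+2 - s n.+1 by [].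
    by lra.
  apply: (@exp_decayM _ 2^-1); last by move=> n _; rewrite ger0_norm.
  apply: exp_decayD => //; apply: exp_decayB.
    by apply: (exp_decayM (M := A)) => // n _; exact: zA.
  apply: (@exp_decayM _ A (fun n => e n.+1)) => [|n _]; first exact: exp_decayS.
  exact: zA.
have mx n : `|m n| <= x.
  by rewrite ger0_norm ?ratio_le// (le_trans _ (ratio_ge1 n)).
have xmx n : `|x - m n| <= x.
  rewrite ger0_norm; first by have := ratio_ge1 n; lra.
  by rewrite subr_ge0 ratio_le.
have : exp_decay (fun n => al n.+2 - al n.+3).
  apply: (@exp_decay_eq _ (fun n =>
      m n.+2 * (m n.+3 - m n.+2) - (x - m n.+2) * (m n.+2 - m n.+1))).
    by move=> n _; rewrite !ratio_riccati; ring.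
  apply: exp_decayB.
    apply: (@exp_decayM _ x (fun n => m n.+3 - m n.+2)) => [|n _].
      exact: (exp_decayS mC).
    exact: mx.
  by apply: (exp_decayM (M := x)) => // n _; exact: xmx.
move=> /(@exp_decay_pred _ (fun n => al n.+1 - al n.+2)).
exact: not_exp_decay_alphaB.
Qed.

(** The perturbed coefficient is the square root of [al n * rho n / rho n.-1],
where [rho n = D n.+1 / D n]; if the difference decays, so do the increments of
[rho]. The ratio of the increments of [D] is a function of [rho], so that its
increments decay too, and so do those of its square root [t], the ratio of
consecutive orthonormal polynomials at [x]. But [t] satisfies
[a n.+2 * t n.+1 + a n.+1 / t n = x]: the increments of the coefficients [a]
would decay as well, as the monotonicity of [a] prevents a cancellation between
the two terms. *)
Lemma a_perturbation_not_exp_decay :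
  ~ exp_decay (fun n =>
      Num.sqrt (al n * (D n.+1 * D n.-1 / D n ^+ 2)) - Num.sqrt (al n)).
Proof.
set e := (fun n => _) => eC.
have [A A0 DA] := factor_le_increment.
pose a n := Num.sqrt (al n).
have a_gt0 n : 0 < a n.+1 by rewrite sqrtr_gt0 legendre_alpha_gt0.
have aa n : a n.+1 ^+ 2 = al n.+1.
  by rewrite sqr_sqrtr// ltW// legendre_alpha_gt0.
have a_ge1 n : 1 <= a n.+1.
  by rewrite -sqrtr1 ler_wsqrtr// legendre_alpha_ge1.
have a_le2 n : a n.+1 <= 2.
  apply: le_trans (legendre_alpha_le2 n).
  by rewrite -aa expr2 ler_peMr// ltW.
have a_decr n : a n.+2 <= a n.+1 by rewrite ler_wsqrtr// legendre_alpha_decr.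
have [C C0 eb] := exp_decay_bounded eC.
pose sig n := w n / D n; pose rho n := D n.+1 / D n.
have rhoE n : rho n = 1 + sig n.
  by rewrite /rho DS -/(w n) mulrDl divff// gt_eqF ?factor_gt0.
have sig_gt0 n : 0 < sig n by rewrite divr_gt0 ?increment_gt0 ?factor_gt0.
have sig_ge n : A^-1 <= sig n.
  rewrite ler_pdivlMr ?factor_gt0// mulrC ler_pdivrMr// mulrC; exact: DA.
have sig_le n : sig n <= lam + x ^+ 2.
  case: n => [|n].
    by rewrite /sig D0 /w v0 h0 expr1n !divr1 mulr1 lerDl sqr_ge0.
  apply: (@le_trans _ _ (w n.+1 / w n)).
    rewrite /sig ler_pM2l ?increment_gt0//.
    rewrite lef_pV2 ?posrE ?increment_gt0 ?factor_gt0//.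
    by rewrite DS -/(w n) lerDr ltW ?factor_gt0.
  rewrite increment_ratio (@le_trans _ _ (x ^+ 2))//; last by rewrite lerDr ltW.
  rewrite ler_pdivrMr ?legendre_alpha_gt0//.
  have : m n ^+ 2 <= x ^+ 2.
    by rewrite lerXn2r ?nnegrE ?ratio_le ?(ltW x_gt0)
               ?(le_trans _ (ratio_ge1 n)).
  have := @legendre_alpha_ge1 R n; have : 0 <= x ^+ 2 by rewrite sqr_ge0.
  nra.
pose B := 1 + lam + x ^+ 2.
have rho_bd n : 0 < rho n <= B.
  by rewrite rhoE /B; have := sig_gt0 n; have := sig_le n; lra.
have gC : exp_decay (fun n => rho n.+2 - rho n.+1).
  have gE n : rho n.+1 - rho n =
      (rho n / al n.+1 * (e n.+1 + 2 * a n.+1)) * e n.+1.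
    pose b := Num.sqrt (al n.+1 * (D n.+2 * D n / D n.+1 ^+ 2)).
    have bb : b ^+ 2 = al n.+1 * (rho n.+1 / rho n).
      rewrite sqr_sqrtr; last first.
        apply: mulr_ge0; first exact/ltW/legendre_alpha_gt0.
        by rewrite divr_ge0 ?mulr_ge0 ?exprn_ge0 ?(ltW (factor_gt0 _)).
      rewrite /rho; congr (_ * _).
      have d1 := factor_gt0 n; have d2 := factor_gt0 n.+1.
      by field; rewrite !gt_eqF.
    have -> : (rho n / al n.+1 * (e n.+1 + 2 * a n.+1)) * e n.+1
        = rho n / al n.+1 * (b ^+ 2 - a n.+1 ^+ 2).
      by rewrite /e /= -/b -/(a n.+1); ring.
    rewrite bb aa; have /andP[r0 _] := rho_bd n.
    have l0 := @legendre_alpha_gt0 R n.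
    by field; rewrite !gt_eqF.
  apply: (@exp_decay_eq _ (fun n =>
      (rho n.+1 / al n.+2 * (e n.+2 + 2 * a n.+2)) * e n.+2)).
    by move=> n _; rewrite gE.
  apply: (@exp_decayM _ (B * (C + 4)) (fun n => e n.+2)).
    by apply: (@exp_decayS _ (fun n => e n.+1)); exact: exp_decayS.
  move=> n _; rewrite normrM ler_pM//.
    have /andP[r0 rB] := rho_bd n.+1.
    have l0 := @legendre_alpha_gt0 R n.+1.
    rewrite ger0_norm; last exact: divr_ge0 (ltW r0) (ltW l0).
    rewrite ler_pdivrMr//.
    by have := @legendre_alpha_ge1 R n.+1; nra.
  rewrite (le_trans (ler_normD _ _))// lerD ?eb// ger0_norm.
    by have := a_le2 n.+1; lra.
  by rewrite mulr_ge0// ltW.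
pose tau n := w n.+1 / w n.
have tauE n : tau n = rho n + rho n / sig n * (rho n.+1 - rho n).
  rewrite !rhoE /tau /sig.
  have w1 := increment_gt0 n; have w2 := increment_gt0 n.+1.
  have d1 := factor_gt0 n.
  have d2 : 0 < D n + w n by rewrite addr_gt0.
  rewrite DS -/(w n); field; by do ?[apply/andP; split]; rewrite gt_eqF.
have fC : exp_decay (fun n => rho n.+1 / sig n.+1 * (rho n.+2 - rho n.+1)).
  apply: (exp_decayM (M := B * A)) => // n _.
  have /andP[r0 rB] := rho_bd n.+1.
  rewrite ger0_norm; last exact: divr_ge0 (ltW r0) (ltW (sig_gt0 _)).
  apply: ler_pM; rewrite ?invr_ge0 ?(ltW r0) ?(ltW (sig_gt0 _))//.
  by rewrite invf_ple ?posrE.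
have tC : exp_decay (fun n => tau n.+2 - tau n.+1).
  apply: (@exp_decay_eq _ (fun n => (rho n.+2 - rho n.+1) +
     (rho n.+2 / sig n.+2 * (rho n.+3 - rho n.+2) -
      rho n.+1 / sig n.+1 * (rho n.+2 - rho n.+1)))).
    by move=> n _; rewrite !tauE; ring.
  by apply: exp_decayD => //; apply: exp_decayB => //; exact: (exp_decayS fC).
pose t n := m n / a n.+1.
have tt n : t n ^+ 2 = tau n by rewrite /tau increment_ratio expr_div_n aa.
have t_ge0 n : 0 <= t n.
  by rewrite divr_ge0// ltW// (lt_le_trans _ (ratio_ge1 n)).
have t_ge1 n : 1 <= t n.
  have : x ^+ 2 / 4 <= t n ^+ 2 by rewrite tt increment_ratio_ge.
  have : 1 <= x ^+ 2 / 4 by have x2 := x_gt2; nra.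
  by have := t_ge0 n; nra.
have dt n : `|t n.+1 - t n| <= `|tau n.+1 - tau n|.
  rewrite -!tt subr_sqr normrM ler_peMr// ger0_norm ?addr_ge0//.
  by have := t_ge1 n; have := t_ge0 n.+1; lra.
have rec n : a n.+2 * t n.+1 + a n.+1 / t n = x.
  have mn : 0 < m n by rewrite (lt_le_trans _ (ratio_ge1 n)).
  have -> : a n.+1 / t n = al n.+1 / m n.
    by rewrite -aa /t; have an := a_gt0 n; field; rewrite !gt_eqF.
  rewrite ratio_riccati /t [a _ * _]mulrC divfK ?gt_eqF// [m n * _]mulrC.
  by rewrite mulfK ?gt_eqF// addrC subrK.
have step n : al n.+2 - al n.+3 <=
    8 * (`|tau n.+2 - tau n.+1| + `|tau n.+1 - tau n|).
  have r1 := rec n; have r2 := rec n.+1.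
  have T0 := t_ge1 n; have T1 := t_ge1 n.+1; have T2 := t_ge1 n.+2.
  (* The difference of two consecutive instances of rec; both terms on the left
     are nonnegative. *)
  have E : (a n.+2 - a n.+3) * t n.+2 + (a n.+1 - a n.+2) / t n =
     a n.+2 * (t n.+2 - t n.+1) + a n.+2 * ((t n - t n.+1) / (t n * t n.+1)).
    have -> : (t n - t n.+1) / (t n * t n.+1) = (t n.+1)^-1 - (t n)^-1.
      by field; rewrite !gt_eqF// (lt_le_trans _ T0, lt_le_trans _ T1).
    by move: r1; rewrite -r2; lra.
  have E1 : a n.+2 - a n.+3 <= (a n.+2 - a n.+3) * t n.+2.
    by rewrite ler_peMr// subr_ge0.
  have E2 : 0 <= (a n.+1 - a n.+2) / t n by rewrite divr_ge0// subr_ge0.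
  have E3 : a n.+2 * (t n.+2 - t n.+1) <= 2 * `|tau n.+2 - tau n.+1|.
    apply: (le_trans (ler_norm _)); rewrite normrM ler_pM//.
    by rewrite ger0_norm// ltW.
  have E4 : a n.+2 * ((t n - t n.+1) / (t n * t n.+1)) <=
      2 * `|tau n.+1 - tau n|.
    apply: (le_trans (ler_norm _)); rewrite normrM ler_pM//.
      by rewrite ger0_norm// ltW.
    rewrite normrM distrC (le_trans _ (dt n))// ler_piMr//.
    have p1 : 1 <= t n * t n.+1 by nra.
    have p0 : 0 < t n * t n.+1 by lra.
    by rewrite ger0_norm ?invr_ge0 ?(ltW p0)// invf_le1.
  have : al n.+2 - al n.+3 = (a n.+2 + a n.+3) * (a n.+2 - a n.+3).
    by rewrite -!aa; ring.
  move=> ->; apply: (@le_trans _ _ (4 * (a n.+2 - a n.+3))).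
    rewrite ler_wpM2r ?subr_ge0//.
    by have := a_le2 n.+1; have := a_le2 n.+2; lra.
  lra.
have : exp_decay (fun n => al n.+3 - al n.+4).
  have tC' : exp_decay (fun n =>
      `|tau n.+3 - tau n.+2| + `|tau n.+2 - tau n.+1|).
    apply: exp_decayD.
      apply: (exp_decay_le (M := 1) (exp_decayS tC)) => n _.
      by rewrite normr_id mul1r.
    by apply: (exp_decay_le (M := 1) tC) => n _; rewrite normr_id mul1r.
  apply: (exp_decay_le (M := 8) tC') => n _.
  rewrite ger0_norm ?subr_ge0 ?legendre_alpha_decr//.
  by rewrite ger0_norm ?addr_ge0// step.
move=> /(@exp_decay_pred _ (fun n => al n.+2 - al n.+3)).
move=> /(@exp_decay_pred _ (fun n => al n.+1 - al n.+2)).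
exact: not_exp_decay_alphaB.
Qed.
End asymptotics.

(** * The uniform law on [[-2, 2]] *)

Section uniform_legendre.
Context {R : realType}.

Lemma ltN22 : (-2 : R) < 2. Proof. by rewrite gtrN. Qed.

Definition uniform22 : probability (measurableTypeR R) R := uniform_prob ltN22.

Definition legendre_norm n : R := \prod_(1 <= k < n.+1) legendre_alpha k.

Lemma uniform_scalar : scalar (poly_integral uniform22).
Proof.
move=> c p q; exact: poly_integral_linear (integrates_polys_uniform ltN22).
Qed.

Lemma poly_integral_legendre n : poly_integral uniform22 (legendre n.+1) = 0.
Proof.
have : poly_integral uniform22 (n.+2%:R *: legendre n.+1) = 0.
  transitivity (poly_integral uniform22 (legendre_primitive n)^`()).
    by apply: eq_Rintegral => x _; rewrite hornerZ legendre_antideriv.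
  by rewrite poly_integral_uniform_deriv legendre_primitive_at2
             legendre_primitive_atN2 subrr mul0r.
rewrite (lin_ellZ _ _ uniform_scalar).
by move/eqP; rewrite mulf_eq0 pnatr_eq0 /= => /eqP.
Qed.

Lemma legendre_monic_orthogonal :
  monic_orthogonal (poly_integral uniform22) legendre legendre_norm.
Proof.
apply: favard uniform_scalar (poly_integral1 _) legendre0 legendreS _ _.
- exact: legendre_alpha_gt0.
- exact: poly_integral_legendre.
Qed.

Lemma legendre_normS n :
  legendre_norm n.+1 = legendre_norm n * legendre_alpha n.+1.
Proof. by rewrite /legendre_norm big_nat_recr. Qed.

Lemma legendre_jacobi_a n : (1 <= n)%N ->
  jacobi_a legendre_norm n = Num.sqrt (legendre_alpha n).
Proof.
case: n => // n _; rewrite /jacobi_a /= legendre_normS mulrAC divff ?mul1r//.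
by rewrite gt_eqF// (mo_gt0 legendre_monic_orthogonal).
Qed.

Variables (x0 beta : R) (beta_gt0 : 0 < beta) (beta_lt1 : beta < 1).
Let nu := insert_mass uniform22 x0 beta_gt0 beta_lt1.
Let lam := beta / (1 - beta).
Let q' := mass_poly (legendre : nat -> {poly R}) legendre_norm x0 lam.
Let h' n :=
  (1 - beta) * mass_h (legendre : nat -> {poly R}) legendre_norm x0 lam n.

Let onem_gt0 : 0 < 1 - beta. Proof. by rewrite subr_gt0. Qed.
Let lam_gt0 : 0 < lam. Proof. by rewrite divr_gt0. Qed.

(** Up to the factor [1 - beta], which does not affect orthogonality, the new
functional is the old one plus the mass [lam = beta / (1 - beta)] at [x0]. *)
Lemma insert_mass_monic_orthogonal : monic_orthogonal (poly_integral nu) q' h'.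
Proof.
have -> : poly_integral nu =
    (fun p => (1 - beta) * mass_ell (poly_integral uniform22) x0 lam p).
  apply/funext => p; rewrite poly_integral_insert_mass; last first.
    exact: integrates_polys_uniform.
  by rewrite /mass_ell /lam; field; rewrite gt_eqF.
apply: monic_orthogonal_scale => //; apply: mass_monic_orthogonal => //.
- exact: uniform_scalar.
- exact: legendre_monic_orthogonal.
Qed.

Lemma recursion_coefs_insert_mass :
  recursion_coefs nu (jacobi_a h') (jacobi_b q').
Proof.
apply: recursion_coefs_jacobi insert_mass_monic_orthogonal _ _.
- move=> c p q; apply: poly_integral_linear.
  apply: integrates_polys_insert_mass; exact: integrates_polys_uniform.
- exact: L2dotE.
Qed.

Hypothesis x0_out : x0 \notin `[-2, 2].
Let y := `|x0|.
Let D := mass_factor (legendre : nat -> {poly R}) legendre_norm y lam.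

Let y_gt2 : 2 < y.
Proof.
by move: x0_out; rewrite in_itv/= /y -ler_norml -ltNge.
Qed.

(* The values of the Legendre polynomials enter the factors through their
   squares, so that negative [x0] reduce to positive ones. *)
Let D_parity : mass_factor (legendre : nat -> {poly R}) legendre_norm x0 lam = D.
Proof.
apply/funext => n; rewrite /D /mass_factor /cd_diag; congr (1 + _ * _).
apply: eq_bigr => k _; congr (_ / _); rewrite /y.
case: (ger0P x0) => // _; rewrite legendre_parity exprMn -exprM muln2 -signr_odd.
by rewrite odd_double mul1r.
Qed.

Lemma jacobi_a_insert_mass n : (1 <= n)%N ->
  jacobi_a h' n = Num.sqrt (legendre_alpha n * (D n.+1 * D n.-1 / D n ^+ 2)).
Proof.
case: n => // n _; rewrite /jacobi_a; congr Num.sqrt.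
rewrite /h' /mass_h D_parity legendre_normS /=.
have D0 k : 0 < D k by exact: (mass_factor_gt0 legendre_monic_orthogonal).
have h0 := mo_gt0 legendre_monic_orthogonal n.
have d0 := D0 n; have d1 := D0 n.+1.
by field; do ?[apply/andP; split]; rewrite gt_eqF.
Qed.

Let s (x : R) n :=
  lam * (legendre n).[x] * (legendre n.+1).[x] / (legendre_norm n * D n.+1).

Lemma jacobi_b_insert_mass n :
  jacobi_b q' n.+2 - jacobi_b legendre n.+2 = s x0 n.+1 - s x0 n.
Proof.
rewrite /jacobi_b /q' ![n.+2.-1]/=.
rewrite !(subleading_mass_poly legendre_monic_orthogonal)//.
by rewrite D_parity /s; ring.
Qed.

Lemma legendre_horner0 : (legendre 0).[y] = 1.
Proof. by rewrite legendre0 hornerC. Qed.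

Lemma legendre_horner1 : (legendre 1).[y] = y.
Proof. by rewrite legendreS legendre0 subr0 mulr1 hornerX. Qed.

Lemma legendre_hornerSS n : (legendre n.+2).[y] =
  y * (legendre n.+1).[y] - legendre_alpha n.+1 * (legendre n).[y].
Proof. by rewrite legendreSS !hornerE. Qed.

Lemma legendre_norm0 : legendre_norm 0 = 1.
Proof. by rewrite /legendre_norm big_geq. Qed.

Lemma mass_factor0 : D 0 = 1.
Proof. by rewrite /D /mass_factor /cd_diag big_ord0 mulr0 addr0. Qed.

Lemma jacobi_a_insert_mass_not_exp_decay :
  ~ exp_decay (fun n => jacobi_a h' n - jacobi_a legendre_norm n).
Proof.
move=> dC.
apply: (a_perturbation_not_exp_decay y_gt2 lam_gt0 legendre_horner0
  legendre_horner1 legendre_hornerSS legendre_norm0 legendre_normS mass_factor0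
  (mass_factorS _ _ _ _)).
apply: exp_decay_eq dC => n n1.
by rewrite jacobi_a_insert_mass// legendre_jacobi_a.
Qed.

Let s_parity n : s x0 n = Num.sg x0 * s y n.
Proof.
rewrite /s /y; case: (ltgtP x0 0) => [xn|xp|x00].
- rewrite ltr0_norm// ltr0_sg// !legendre_parity exprS.
  have -> : lam * ((-1) ^+ n * (legendre n).[x0]) *
      (-1 * (-1) ^+ n * (legendre n.+1).[x0]) =
      - (((-1) ^+ n) ^+ 2 *
         (lam * (legendre n).[x0] * (legendre n.+1).[x0])) by ring.
  by rewrite sqrr_sign; ring.
- by rewrite gtr0_norm// gtr0_sg// mul1r.
- by have := y_gt2; rewrite /y x00 normr0 ltNge ler0n.
Qed.

Lemma jacobi_b_insert_mass_not_exp_decay :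
  ~ exp_decay (fun n => jacobi_b q' n - jacobi_b legendre n).
Proof.
move=> dC.
apply: (b_perturbation_not_exp_decay y_gt2 lam_gt0 legendre_horner0
  legendre_horner1 legendre_hornerSS legendre_norm0 legendre_normS mass_factor0
  (mass_factorS _ _ _ _)).
have sC : exp_decay (fun n => s x0 n - s x0 n.-1).
  apply: exp_decay_pred.
  apply: exp_decay_eq (exp_decayS (exp_decayS dC)) => n _.
  by rewrite jacobi_b_insert_mass.
have : exp_decay (fun n => Num.sg x0 * (s x0 n - s x0 n.-1)).
  apply: (exp_decayM (M := 1)) => // n _.
  by rewrite normr_sg lern1 leq_b1.
apply: exp_decay_eq => n _; rewrite !s_parity -mulrBr mulrA -expr2 sqr_sg.
have -> : x0 != 0.
  by apply/eqP => x00; have := y_gt2; rewrite /y x00 normr0 ltNge ler0n.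
by rewrite mul1r.
Qed.
End uniform_legendre.

Theorem theorem1p1 (R : realType) :
  exists gamma0 : probability (measurableTypeR R) R,
    [/\ gamma0 `<< @lebesgue_measure R,
        msupport gamma0 = `[-2, 2]%classic,
        (forall x : R, x \notin `[-2, 2] -> gamma0 [set x] = 0%E) &
        exists a b : nat -> R, recursion_coefs gamma0 a b /\
          forall (x0 beta : R) (beta_gt0 : 0 < beta) (beta_lt1 : beta < 1),
            x0 \notin `[-2, 2] ->
            exists a' b' : nat -> R,
              [/\ recursion_coefs
                    (insert_mass gamma0 x0 beta_gt0 beta_lt1) a' b',
                  ~ exp_decay (fun n => a' n - a n) &
                  ~ exp_decay (fun n => b' n - b n)]].
Proof.
exists (@uniform22 R); split.
- exact: dominates_uniform_prob.
- exact: msupport_uniform.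
- by move=> x _; exact: uniform_prob_set1.
exists (jacobi_a (@legendre_norm R)), (jacobi_b legendre); split.
  apply: recursion_coefs_jacobi (@uniform_scalar R)
    (@legendre_monic_orthogonal R) _ _.
  exact: L2dotE.
move=> x0 beta beta_gt0 beta_lt1 x0_out.
do 2 eexists; split.
- exact: recursion_coefs_insert_mass.
- exact: jacobi_a_insert_mass_not_exp_decay.
- exact: jacobi_b_insert_mass_not_exp_decay.
Qed.
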